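(* Let $K\subset L$ be commutative fields such that every element of $L$ that is algebraic over $K$ is separable over $K$. Let $A,B,C$ be finite-dimensional $K$-subspaces of $L$ with $A\neq\{0\}$, $B\neq\{0\}$ and $K\subset C$. Then either $\langle ABC\rangle=\langle AB\rangle$ or $\dim_K\langle ABC\rangle\geq\dim_KA+\dim_KB$.
   Context: For $S\subset L$, $\langle S\rangle$ denotes the $K$-subspace of $L$ spanned by $S$. Product sets: $AB=\{ab\mid a\in A,b\in B\}$, $ABC=\{abc\mid a\in A,b\in B,c\in C\}$. *)

(* Defs.v *)
(* K ⊂ L modelled as a field morphism f : K -> L
   (automatically injective); L is a K-vector space via k . x := f k * x. *)
From HB Require Import structures.
From mathcomp Require Import all_boot all_order all_algebra all_field.
Set Implicit Arguments. Unset Strict Implicit. Unset Printing Implicit Defensive.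
Import GRing.Theory.
Local Open Scope ring_scope.

Definition lincomb (K L : fieldType) (f : {rmorphism K -> L}) (s : seq L) (c : seq K) : L :=
  \sum_(i < size s) f c`_i * s`_i.

Definition spanK (K L : fieldType) (f : {rmorphism K -> L}) (S : L -> Prop) : L -> Prop :=
  fun x => exists (s : seq L) (c : seq K), (forall y, y \in s -> S y) /\ x = lincomb f s c.

Definition prodset (L : fieldType) (A B : L -> Prop) : L -> Prop :=
  fun z => exists x y, A x /\ B y /\ z = x * y.

Definition freeK (K L : fieldType) (f : {rmorphism K -> L}) (s : seq L) : Prop :=
  forall c : seq K, lincomb f s c = 0 -> forall i, (i < size s)%N -> c`_i = 0.

Definition finDimSubspace (K L : fieldType) (f : {rmorphism K -> L}) (V : L -> Prop) : Prop :=
  exists s : seq L, forall x, V x <-> spanK f (fun y => y \in s) x.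

Definition dimK (K L : fieldType) (f : {rmorphism K -> L}) (V : L -> Prop) (n : nat) : Prop :=
  exists s : seq L, size s = n /\ freeK f s /\ forall x, V x <-> spanK f (fun y => y \in s) x.

Definition algebraicK (K L : fieldType) (f : {rmorphism K -> L}) (x : L) : Prop :=
  exists p : {poly K}, p != 0 /\ root (map_poly f p) x.

(* x is separable over K: root of a separable polynomial over K
   (equivalently its minimal polynomial is separable) *)
Definition separableK (K L : fieldType) (f : {rmorphism K -> L}) (x : L) : Prop :=
  exists p : {poly K}, separable_poly p /\ root (map_poly f p) x.

(* Main.v *)
(** Olson's argument, by Dyson's e-transform.  Fix [c] in [C] and suppose that
    [1] is in [A].  For a nonzero [e] in [B], replacing [(A, B)] by
    [({x in A | x e in B}, B + A e)] keeps the products in [<AB>], does not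
    decrease [dim A + dim B], and enlarges [B].  When no [e] makes [A] smaller,
    [AB] is contained in [B]; then either [c B] is contained in [B], or some [v]
    in [B] has [c v] outside [B], and [B] and [A c v] are in direct sum because
    every nonzero [x] in [A] satisfies [x B = B].  If [c a b] is outside [<AB>],
    apply this to [a^-1 A] and [a B]. *)
Require Import Defs.
From HB Require Import structures.
From Stdlib Require Import Classical.
From mathcomp Require Import all_boot all_order all_algebra all_field.
From mathcomp Require Import ring.
Import GRing.Theory.
Local Open Scope ring_scope.

Lemma not_all_imply (T : Type) (P Q : T -> Prop) :
  ~ (forall x, P x -> Q x) -> exists2 x, P x & ~ Q x.
Proof.
move=> h; have [x nPQ] := not_all_ex_not _ _ h.
by have [Px nQx] := imply_to_and _ _ nPQ; exists x.
Qed.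

(** * Linear combinations and spans in [L] over [K] *)

Section LinearAlgebra.

Set Implicit Arguments. Unset Strict Implicit. Unset Printing Implicit Defensive.

Variables (K L : fieldType) (f : {rmorphism K -> L}).
Implicit Types (s t u : seq L) (c d : seq K) (x y z : L) (S V : L -> Prop).

Local Notation lincomb := (lincomb f).
Local Notation spanK := (spanK f).
Local Notation freeK := (freeK f).

Definition spanSeq s : L -> Prop := spanK (fun y => y \in s).

Definition subspaceK V : Prop :=
  V 0 /\ forall k x y, V x -> V y -> V (f k * x + y).

Lemma lincomb_nil c : lincomb [::] c = 0.
Proof. by rewrite /Defs.lincomb big_ord0. Qed.

Lemma lincomb_cons x s c :
  lincomb (x :: s) c = f c`_0 * x + lincomb s (behead c).
Proof.
rewrite /Defs.lincomb big_ord_recl /=; congr (_ + _).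
by apply: eq_bigr => i _; rewrite nth_behead.
Qed.

Lemma lincomb_cat s t c :
  lincomb (s ++ t) c = lincomb s c + lincomb t (drop (size s) c).
Proof.
elim: s c => [|x s IH] c; first by rewrite lincomb_nil add0r drop0.
by rewrite cat_cons !lincomb_cons IH addrA /= -drop1 drop_drop addn1.
Qed.

Lemma lincomb_map_mul x s c : lincomb (map ( *%R x) s) c = x * lincomb s c.
Proof.
elim: s c => [|y s IH] c; first by rewrite !lincomb_nil mulr0.
by rewrite /= !lincomb_cons IH mulrDr mulrCA.
Qed.

Lemma subspaceZ V k x : subspaceK V -> V x -> V (f k * x).
Proof. by move=> [V0 h] Vx; have := h k x 0 Vx V0; rewrite addr0. Qed.

Lemma subspaceN V x : subspaceK V -> V x -> V (- x).
Proof.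
by move=> sV Vx; have := subspaceZ (-1) sV Vx; rewrite rmorphN1 mulN1r.
Qed.

Lemma subspace_lincomb V s c :
  subspaceK V -> (forall y, y \in s -> V y) -> V (lincomb s c).
Proof.
move=> sV; elim: s c => [|x s IH] c sub; first by rewrite lincomb_nil; case: sV.
rewrite lincomb_cons; apply: sV.2; first by apply: sub; rewrite mem_head.
by apply: IH => y ys; apply: sub; rewrite inE ys orbT.
Qed.

(** This serves as the induction principle for spans: a condition stable under linear combinations
    only has to be checked on generators. *)
Lemma spanK_min S V :
  subspaceK V -> (forall y, S y -> V y) -> forall x, spanK S x -> V x.
Proof.
move=> sV sub x [s [c [sS ->]]].
by apply: subspace_lincomb => // y /sS /sub.
Qed.

Lemma spanK_subspace S : subspaceK (spanK S).
Proof.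
split; first by exists [::], [::]; rewrite lincomb_nil.
move=> k _ y [s [c [sS ->]]] Sy; elim: s c sS => [|x s IH] c sS.
  by rewrite lincomb_nil mulr0 add0r.
have {IH} [t [d [tS eq_t]]] : spanK S (f k * lincomb s (behead c) + y).
  by apply: IH => z zs; apply: sS; rewrite inE zs orbT.
exists (x :: t), (k * c`_0 :: d); split.
  by move=> z; rewrite inE => /orP[/eqP->|/tS//]; apply: sS; rewrite mem_head.
by rewrite !lincomb_cons /= -eq_t rmorphM; ring.
Qed.

Lemma spanK_incl S x : S x -> spanK S x.
Proof.
move=> Sx; exists [:: x], [:: 1]; split.
  by move=> y; rewrite inE => /eqP->.
by rewrite lincomb_cons lincomb_nil /= rmorph1 mul1r addr0.
Qed.

Lemma spanSeq_subspace s : subspaceK (spanSeq s).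
Proof. exact: spanK_subspace. Qed.

Lemma mem_spanSeq s x : x \in s -> spanSeq s x.
Proof. exact: (@spanK_incl (fun y => y \in s)). Qed.

Lemma spanSeq_lincomb s c : spanSeq s (lincomb s c).
Proof. by exists s, c. Qed.

Lemma spanSeq_consP y s x :
  spanSeq (y :: s) x -> exists k z, spanSeq s z /\ x = f k * y + z.
Proof.
pose V x := exists k z, spanSeq s z /\ x = f k * y + z.
have sS := spanSeq_subspace s; apply: (@spanK_min _ V).
  split; first by exists 0, 0; split; [exact: sS.1 | rewrite rmorph0; ring].
  move=> k _ _ [k1 [z1 [h1 ->]]] [k2 [z2 [h2 ->]]].
  exists (k * k1 + k2), (f k * z1 + z2); split; first exact: sS.2.
  by rewrite rmorphD rmorphM; ring.
move=> z; rewrite inE => /orP[/eqP->|zs].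
  by exists 1, 0; split; [exact: sS.1 | rewrite rmorph1; ring].
by exists 0, z; split; [exact: mem_spanSeq | rewrite rmorph0; ring].
Qed.

(** A witness for [spanK] may list members of [s] in any order and with repetitions; splitting off
    one generator at a time collects the coefficients along [s] itself. *)
Lemma spanSeqP s x : spanSeq s x -> exists c, x = lincomb s c.
Proof.
elim: s x => [|y s IH] x.
  move=> [[|z s] [c [sub ->]]]; last by have := sub z (mem_head _ _).
  by exists [::]; rewrite !lincomb_nil.
move=> /spanSeq_consP[k [z [/IH[c ->] ->]]].
by exists (k :: c); rewrite lincomb_cons.
Qed.

Lemma spanSeq_sub s t :
  {subset s <= t} -> forall x, spanSeq s x -> spanSeq t x.
Proof.
move=> sub; apply: spanK_min; first exact: spanSeq_subspace.
by move=> y /sub; exact: mem_spanSeq.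
Qed.

Lemma spanSeq_mul s t x y :
  spanSeq s x -> spanSeq t y -> spanSeq [seq a * b | a <- s, b <- t] (x * y).
Proof.
set r := [seq _ | a <- s, b <- t] => sx ty.
have sS := spanSeq_subspace r.
move: x sx; apply: spanK_min => [|a a_s].
  split=> [|k x1 x2 h1 h2]; first by rewrite mul0r; exact: sS.1.
  by rewrite mulrDl -mulrA; exact: sS.2.
move: y ty; apply: spanK_min => [|b b_t].
  split=> [|k x1 x2 h1 h2]; first by rewrite mulr0; exact: sS.1.
  by rewrite mulrDr mulrCA; exact: sS.2.
by apply: mem_spanSeq; apply/allpairsP; exists (a, b).
Qed.

(** * Free families *)

Lemma freeK_nil : freeK [::].
Proof. by []. Qed.

Lemma freeK_cons x s : freeK s -> ~ spanSeq s x -> freeK (x :: s).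
Proof.
move=> free_s nsx c; rewrite lincomb_cons => eq0.
have c0 : c`_0 = 0.
  apply/eqP/negPn/negP => c0; apply: nsx.
  suff -> : x = f (- (c`_0)^-1) * lincomb s (behead c).
    exact: (subspaceZ _ (spanSeq_subspace s) (spanSeq_lincomb _ _)).
  have fc0 : f c`_0 != 0 by rewrite fmorph_eq0.
  have -> : lincomb s (behead c) = - (f c`_0 * x).
    by apply/eqP; rewrite -addr_eq0 addrC eq0.
  by rewrite rmorphN fmorphV; field.
move: eq0; rewrite c0 rmorph0 mul0r add0r => /free_s h [|i] //= lt_i.
by rewrite -nth_behead h.
Qed.

Lemma freeK_cat s t :
  freeK s -> freeK t -> (forall x, spanSeq s x -> spanSeq t x -> x = 0) ->
  freeK (s ++ t).
Proof.
move=> free_s free_t direct c; rewrite lincomb_cat => eq0 i lt_i.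
have s0 : lincomb s c = 0.
  apply: direct; first exact: spanSeq_lincomb.
  have /eqP -> : lincomb s c == - lincomb t (drop (size s) c).
    by rewrite -addr_eq0 eq0.
  exact: (subspaceN (spanSeq_subspace t) (spanSeq_lincomb _ _)).
case: (ltnP i (size s)) => [|le_i]; first exact: free_s.
move: eq0; rewrite s0 add0r => /free_t/(_ (i - size s)%N).
rewrite nth_drop subnKC //; apply.
by rewrite ltn_subLR // -size_cat.
Qed.

Lemma freeK_catP s t :
  freeK (s ++ t) ->
  [/\ freeK s, freeK t & forall x, spanSeq s x -> spanSeq t x -> x = 0].
Proof.
move=> free_st.
have aux c d : lincomb s c + lincomb t d = 0 ->
    (forall i, (i < size s)%N -> c`_i = 0) /\ (forall i, (i < size t)%N -> d`_i = 0).
  (* The list [c] may be shorter or longer than [s]. Padding or cutting it to exactly [size s]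
     entries makes [d] start at the first index of [t] in [c' ++ d]. *)
  pose c' := mkseq (nth 0 c) (size s) => eq0.
  have eq_c : lincomb s c' = lincomb s c.
    by apply: eq_bigr => i _; rewrite nth_mkseq.
  have eq_c' : lincomb s (c' ++ d) = lincomb s c.
    by rewrite -eq_c; apply: eq_bigr => i _; rewrite nth_cat size_mkseq ltn_ord.
  have h : lincomb (s ++ t) (c' ++ d) = 0.
    by rewrite lincomb_cat drop_size_cat ?size_mkseq // eq_c'.
  have {}h := free_st _ h; split=> i lt_i.
    have := h i; rewrite size_cat nth_cat size_mkseq lt_i nth_mkseq //.
    by apply; apply: ltn_addr.
  have := h (size s + i)%N.
  by rewrite size_cat ltn_add2l nth_cat size_mkseq [(size s + i < _)%N]ltnNge leq_addr /= addKn; apply.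
have lincomb0 r : lincomb r [::] = 0.
  by apply: big1 => i _; rewrite nth_nil rmorph0 mul0r.
split.
- by move=> c eq0; apply: (aux c [::] _).1; rewrite eq0 lincomb0 addr0.
- by move=> c eq0; apply: (aux [::] c _).2; rewrite eq0 lincomb0 addr0.
move=> x /spanSeqP[c eq_x] /(subspaceN (spanSeq_subspace t))/spanSeqP[d eq_d].
have [|c0 _] := aux c d; first by rewrite -eq_x -eq_d subrr.
by rewrite eq_x; apply: big1 => i _; rewrite c0 // rmorph0 mul0r.
Qed.

Lemma freeK_map_mul x s : x != 0 -> freeK s -> freeK (map ( *%R x) s).
Proof.
move=> x0 free_s c; rewrite lincomb_map_mul size_map => /eqP.
by rewrite mulf_eq0 (negPf x0) => /eqP; exact: free_s.
Qed.

Lemma spanSeq_map_mul x s y :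
  spanSeq (map ( *%R x) s) y -> exists2 z, spanSeq s z & y = x * z.
Proof.
move=> /spanSeqP[c ->]; exists (lincomb s c); first exact: spanSeq_lincomb.
exact: lincomb_map_mul.
Qed.

(** * Exchange, bases and dimension *)

(** If [s] were longer than [t], the matrix of coordinates of [s] along [t] would have more rows
    than columns. A nonzero row vector in its left kernel is then a nontrivial relation on [s]. *)
Lemma steinitz s t :
  freeK s -> (forall y, y \in s -> spanSeq t y) -> (size s <= size t)%N.
Proof.
move=> free_s sub; rewrite leqNgt; apply/negP => lt_ts.
have /fin_all_exists[g gP] (i : 'I_(size s)) : exists c, s`_i = lincomb t c.
  by apply/spanSeqP/sub/mem_nth.
pose M := \matrix_(i < size s, j < size t) (g i)`_j.
have : kermx M != 0.
  by rewrite kermx_eq0 /row_free neq_ltn (leq_ltn_trans (rank_leq_col M)).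
case/rowV0Pn => u /sub_kermxP uM0 /eqP; apply; apply/rowP => i.
have nth_u (j : 'I_(size s)) : [seq u 0 k | k : 'I_(size s)]`_j = u 0 j.
  by rewrite (nth_map j) ?size_enum_ord // nth_ord_enum.
rewrite mxE -nth_u; apply: free_s => //.
rewrite /Defs.lincomb.
under eq_bigr => j _ do rewrite nth_u gP /Defs.lincomb mulr_sumr.
rewrite exchange_big big1 // => j _ /=.
transitivity (f ((u *m M) 0 j) * t`_j); last by rewrite uM0 mxE rmorph0 mul0r.
rewrite mxE rmorph_sum mulr_suml; apply: eq_bigr => k _.
by rewrite mxE rmorphM mulrA.
Qed.

(** Adjoin missing vectors one by one; [steinitz] bounds the length by [size t], so this stops. With
    [s] empty it yields a basis, and in general [u] spans a complement of the span of [s] in [V]. *)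
Lemma basis_extension V s t :
  subspaceK V -> (forall x, V x -> spanSeq t x) ->
  freeK s -> (forall y, y \in s -> V y) ->
  exists u, [/\ freeK (u ++ s), forall y, y \in u -> V y
             & forall x, V x -> spanSeq (u ++ s) x].
Proof.
move=> sV subt; have [n] := ubnP (size t - size s).
elim: n s => // n IH s lt_n free_s subV.
have [h|nh] := classic (forall x, V x -> spanSeq s x); first by exists [::].
have [x Vx nsx] := not_all_imply _ _ _ nh.
have free_xs := freeK_cons free_s nsx.
have xsV y : y \in x :: s -> V y by rewrite inE => /orP[/eqP->|/subV].
have le_t : (size (x :: s) <= size t)%N.
  by apply: steinitz free_xs _ => y /xsV /subt.
have [|u [free_u uV span_u]] := IH (x :: s) _ free_xs xsV.
  by rewrite -ltnS; apply: leq_trans lt_n; rewrite ltnS ltn_sub2l.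
exists (rcons u x); rewrite cat_rcons; split=> // y.
by rewrite mem_rcons inE => /orP[/eqP->|/uV].
Qed.

(** A vector of [V] missed by [t] would extend [t] to a free family longer than the generating
    family [s]. *)
Lemma freeK_size_span V s t :
  (forall x, V x -> spanSeq s x) -> freeK t -> (forall y, y \in t -> V y) ->
  size t = size s -> forall x, V x -> spanSeq t x.
Proof.
move=> subs free_t tV eq_ts x Vx; apply: NNPP => ntx.
suff : (size (x :: t) <= size s)%N by rewrite /= eq_ts ltnn.
apply: steinitz (freeK_cons free_t ntx) _ => y.
by rewrite inE => /orP[/eqP->|/tV]; exact: subs.
Qed.

Lemma finDimSubspace_basis V :
  finDimSubspace f V ->
  exists s, [/\ freeK s, forall x, V x <-> spanSeq s x & dimK f V (size s)].
Proof.
move=> [t tP].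
have [//|//|u []] := basis_extension (spanSeq_subspace t) (t := t) _ freeK_nil.
rewrite cats0 => free_u ut tu.
have uP x : V x <-> spanSeq u x.
  split=> [/tP/tu//|ux]; apply/tP; move: x ux; apply: spanK_min => //.
  exact: spanSeq_subspace.
by exists u; split=> //; exists u.
Qed.

End LinearAlgebra.

(** * Dyson's e-transform *)

(** The spaces [P] and [X] stand for the spans of [AB] and [ABC]. They stay fixed while [A] and [B]
    change, so the induction on [dim A] only has to preserve that the products lie in [P] and that 1
    is in [A]. *)
Lemma dyson_dichotomy (K L : fieldType) (f : {rmorphism K -> L}) (c : L)
    (P X : L -> Prop) (sA sB : seq L) :
  subspaceK f P -> subspaceK f X ->
  (forall x, P x -> X x) -> (forall x, P x -> X (c * x)) ->
  freeK f sA -> freeK f sB -> spanSeq f sA 1 ->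
  (forall a b, spanSeq f sA a -> spanSeq f sB b -> P (a * b)) ->
  (forall b, spanSeq f sB b -> P (c * b)) \/
  (exists s, [/\ freeK f s, forall y, y \in s -> X y
              & (size sA + size sB <= size s)%N]).
Proof.
move=> sP sX PX cPX; have [n] := ubnP (size sA).
elim: n sA sB => // n IH sA sB lt_n freeA freeB A1 ABP.
set A := spanSeq f sA in A1 ABP *; set B := spanSeq f sB in ABP *.
have sA_ : subspaceK f A := spanSeq_subspace _ _.
have sB_ : subspaceK f B := spanSeq_subspace _ _.
have BP b : B b -> P b by move=> Bb; rewrite -[b]mul1r; exact: ABP.
have [stable|] := classic (forall e, B e -> forall a, A a -> B (a * e)).
  have [cB|] := classic (forall v, B v -> B (c * v)).
    by left=> b /cB/BP.
  move=> /not_all_imply[v Bv ncv]; right.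
  have cv0 : c * v != 0 by apply/eqP => h; apply: ncv; rewrite h; case: sB_.
  exists (sB ++ map ( *%R (c * v)) sA); split; last first.
  - by rewrite size_cat size_map addnC.
  - move=> y; rewrite mem_cat => /orP[/(mem_spanSeq f)/BP/PX//|/mapP[a /(mem_spanSeq f) Aa ->]].
    by rewrite -mulrA [v * a]mulrC; apply: cPX; apply: ABP.
  apply: freeK_cat => //; first exact: freeK_map_mul.
  (* For nonzero [a], the space [a B] lies in [B] and has the same dimension, so it equals [B]. Then
     [c * v * a] in [B] has the form [a * b], and cancelling [a] puts [c * v] in [B]. *)
  move=> _ /[swap] /spanSeq_map_mul[a Aa ->] Bcva.
  have [->|a0] := eqVneq a 0; first by rewrite mulr0.
  have : spanSeq f (map ( *%R a) sB) (c * v * a).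
    apply: (@freeK_size_span _ _ f B sB) => //; last by rewrite size_map.
    + exact: freeK_map_mul.
    + by move=> _ /mapP[b /(mem_spanSeq f) Bb ->]; exact: stable.
  move=> /spanSeq_map_mul[b Bb eq_b].
  by case: ncv; rewrite [c * v](_ : _ = b) //; apply: (mulfI a0); rewrite mulrC.
move=> /not_all_imply[e Be /not_all_imply[a0 Aa0 nB]].
have e0 : e != 0 by apply/eqP => h; apply: nB; rewrite h mulr0; case: sB_.
(* This is the first half of the transform. It contains 1 because [e] is in [B], and it misses [a0],
   so its dimension is smaller than that of [A]. *)
pose A' x := A x /\ B (x * e).
have sA' : subspaceK f A'.
  split=> [|k x y [Ax Bx] [Ay By]]; first by split; rewrite ?mul0r; [case: sA_ | case: sB_].
  split; first exact: sA_.2.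
  by rewrite mulrDl -mulrA; apply: sB_.2.
have [||w [/[!cats0] freew wA' A'w]] :=
  basis_extension (t := sA) sA' _ (@freeK_nil _ _ f) _;
  [by move=> x [] | by [] |].
have spanw x : spanSeq f w x -> A' x by move: x; apply: spanK_min.
have lt_w : (size w < size sA)%N.
  apply: (@steinitz _ _ f (a0 :: w) sA).
    by apply: freeK_cons => // /spanw[].
  by move=> y; rewrite inE => /orP[/eqP->|/wA'[]].
have [||u [freeuw uA Auw]] := basis_extension (t := sA) sA_ _ freew _;
  [by [] | by move=> y /wA'[] |].
have [freeu _ uw0] := freeK_catP freeuw.
have spanu x : spanSeq f u x -> A x by move: x; apply: spanK_min.
have le_sA : (size sA <= size u + size w)%N.
  by rewrite -size_cat; apply: (steinitz freeA) => y /(mem_spanSeq f)/Auw.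
(* Since [A' e] lies in [B], the space [B + A e] is already [B + e <u>]. The sum is direct: if
   [e * a] is in [B] with [a] in the span of [u], then [a] is in [A'], hence zero. So [B] gains the
   [size u] dimensions that [A] loses. *)
have freeB' : freeK f (sB ++ map ( *%R e) u).
  apply: freeK_cat => //; first exact: freeK_map_mul.
  move=> _ /[swap] /spanSeq_map_mul[a ua ->] Bea.
  rewrite (uw0 a) ?mulr0 //; apply: A'w; split; first exact: spanu.
  by rewrite mulrC.
have [|||cB'|[s [frees sX' le_s]]] := IH w (sB ++ map ( *%R e) u) _ freew freeB'.
- exact: leq_trans lt_w _.
- by apply: A'w; split=> //; rewrite mul1r.
(* On a new generator [e * a], regroup [x * (e * a)] as [a * (x * e)], a product of an element of
   [A] and one of [B]. *)
- move=> x y /spanw[Ax Bxe]; move: y; apply: spanK_min.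
    split=> [|k y1 y2 h1 h2]; first by rewrite mulr0; case: sP.
    by rewrite mulrDr mulrCA; apply: sP.2.
  move=> y; rewrite mem_cat => /orP[/(mem_spanSeq f)/(ABP _ _ Ax)//|/mapP[a /uA Aa ->]].
  by rewrite mulrA mulrC; apply: ABP.
- left=> b Bb; apply: cB'; apply: spanSeq_sub Bb => x xs.
  by rewrite mem_cat xs.
right; exists s; split=> //; apply: leq_trans le_s.
by rewrite size_cat size_map addnCA [X in (_ <= X)%N]addnC leq_add2r [(_ w + _)%N]addnC.
Qed.

(** * Reduction of the theorem to the dichotomy *)

Theorem mainTheorem11 (K L : fieldType) (f : {rmorphism K -> L})
  (hsep : forall x : L, algebraicK f x -> separableK f x)
  (A B C : L -> Prop)
  (hA : finDimSubspace f A) (hB : finDimSubspace f B) (hC : finDimSubspace f C)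
  (hA0 : exists a, A a /\ a != 0) (hB0 : exists b, B b /\ b != 0)
  (hKC : forall k : K, C (f k)) :
  (forall z, spanK f (prodset (prodset A B) C) z <-> spanK f (prodset A B) z) \/
  (exists nA nB n, dimK f A nA /\ dimK f B nB /\
     dimK f (spanK f (prodset (prodset A B) C)) n /\ (nA + nB <= n)%N).
Proof.
set P := spanK f (prodset A B); set X := spanK f (prodset (prodset A B) C).
have sP : subspaceK f P := spanK_subspace f _.
have sX : subspaceK f X := spanK_subspace f _.
have ABP a b : A a -> B b -> P (a * b).
  by move=> Aa Bb; apply: spanK_incl; exists a, b.
have PCX c : C c -> forall x, P x -> X (c * x).
  move=> Cc; apply: spanK_min.
    split=> [|k y1 y2 h1 h2]; first by rewrite mulr0; case: sX.
    by rewrite mulrDr mulrCA; apply: sX.2.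
  by move=> x ABx; apply: spanK_incl; exists x, c; rewrite mulrC.
have PX x : P x -> X x.
  by rewrite -{2}[x]mul1r; apply: PCX; rewrite -(rmorph1 f).
have [stable|] := classic (forall c, C c -> forall a, A a ->
    forall b, B b -> P (c * (a * b))).
  left=> z; split; last exact: PX.
  move: z; apply: spanK_min => // _ [_ [c [[a [b [Aa [Bb ->]]]] [Cc ->]]]].
  by rewrite mulrC; apply: stable.
move=> /not_all_imply[c Cc /not_all_imply[a Aa /not_all_imply[b Bb nP]]]; right.
have a0 : a != 0 by apply/eqP => h; apply: nP; rewrite h mul0r mulr0; case: sP.
have [sA [freeA AE dimA]] := finDimSubspace_basis hA.
have [sB [freeB BE dimB]] := finDimSubspace_basis hB.
have [sC [_ CE _]] := finDimSubspace_basis hC.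
(* The triple products of basis vectors generate [X], so it has a dimension. *)
have finX : finDimSubspace f X.
  exists [seq x * y | x <- [seq x * y | x <- sA, y <- sB], y <- sC] => x; split.
    move: x; apply: spanK_min; first exact: spanSeq_subspace.
    move=> _ [_ [z [[x [y [/AE Ax [/BE By ->]]]] [/CE Cz ->]]]].
    by apply: spanSeq_mul => //; apply: spanSeq_mul.
  move: x; apply: spanK_min => // _ /allpairsP[[_ z] [/= /allpairsP[[x y] [/= xs ys ->]] zs ->]].
  apply: spanK_incl; exists (x * y), z; split; last by split=> //; apply/CE/(mem_spanSeq f).
  by exists x, y; do !split; [apply/AE | apply/BE]; apply: mem_spanSeq.
have [sX' [_ XE dimX]] := finDimSubspace_basis finX.
exists (size sA), (size sB), (size sX'); do !split=> //.
(* Passing to [a^-1 A] and [a B] puts 1 in the first space and changes neither the dimensions nor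
   the products. *)
have [||||cP|[s [frees sinX]]] := @dyson_dichotomy _ _ f c P X
    (map ( *%R a^-1) sA) (map ( *%R a) sB) sP sX PX (PCX c Cc).
- by apply: freeK_map_mul => //; rewrite invr_eq0.
- exact: freeK_map_mul.
- have /AE/spanSeqP[d eq_a] := Aa.
  by rewrite -(mulVf a0) {3}eq_a -lincomb_map_mul; exact: spanSeq_lincomb.
- move=> _ _ /spanSeq_map_mul[x /AE Ax ->] /spanSeq_map_mul[y /BE By ->].
  rewrite (_ : a^-1 * x * (a * y) = x * y); first exact: ABP.
  by field.
(* The first alternative, applied to [a * b] in [a B], contradicts the choice of [c], [a] and
   [b]. *)
- case: nP; apply: cP; have /BE/spanSeqP[d ->] := Bb.
  by rewrite -lincomb_map_mul; exact: spanSeq_lincomb.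
rewrite !size_map => /leq_trans; apply.
by apply: (steinitz frees) => y /sinX/XE.
Qed.
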